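(* Let $A\in\mathbb{R}^{m\times n}$. For $w_0\in\mathbb{R}^n$, let $X_0=w_0(Aw_0)^T$ where $Aw_0$ is a unit vector, and then for $k=1,2,3,\ldots$ let $$X_k=X_{k-1}+w_k(Aw_k)^T,$$ where $w_k\in\mathbb{R}^n$ is such that $Aw_k$ is a unit vector orthogonal to the columns of $AX_{k-1}$. Then $X_k$ converges to a pseudoinverse of $A$ satisfying conditions (1), (2), (3), that is, to a matrix $X\in\mathbb{R}^{n\times m}$ such that (1) $AXA=A$; (2) $XAX=X$; (3) $AX$ is self-adjoint.
   Context: Here $\mathbb{R}^{m\times n}$ is the space of real $m\times n$ matrices, and unit vectors and orthogonality are with respect to the Euclidean norm and inner product. Conditions (1), (2), (3) are the first three of the four defining properties of the Moore-Penrose pseudoinverse of $A$; the fourth, that $XA$ is self-adjoint, is not claimed. A pseudoinverse of $A$ satisfying only conditions (1), (2), (3) is called a weak pseudoinverse and is denoted $A^{(1,2,3)}$. *)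

(* Defs.v *)
From HB Require Import structures.
From mathcomp Require Import all_boot all_order all_algebra.
From mathcomp Require Import all_classical all_reals all_analysis.

Set Implicit Arguments.
Unset Strict Implicit.
Unset Printing Implicit Defensive.

Import Order.TTheory GRing.Theory Num.Theory.
Import numFieldNormedType.Exports.
Local Open Scope ring_scope.

Definition dotc (R : realType) (m : nat) (u v : 'cV[R]_m) : R :=
  \sum_(i < m) u i 0 * v i 0.

(* The library norm `|u| on matrices is the max norm, hence this definition. *)
Definition enorm (R : realType) (m : nat) (u : 'cV[R]_m) : R :=
  Num.sqrt (dotc u u).

Definition unit_vector (R : realType) (m : nat) (u : 'cV[R]_m) : Prop :=
  enorm u = 1.

Definition orthogonal_to_columns (R : realType) (m p : nat)
    (u : 'cV[R]_m) (B : 'M[R]_(m, p)) : Prop :=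
  forall j : 'I_p, dotc u (col j B) = 0.

Definition self_adjoint (R : realType) (m : nat) (B : 'M[R]_m) : Prop :=
  B^T = B.

Definition weak_pseudoinverse (R : realType) (m n : nat)
    (A : 'M[R]_(m, n)) (X : 'M[R]_(n, m)) : Prop :=
  [/\ A *m X *m A = A, X *m A *m X = X & self_adjoint (A *m X)].

Definition admissible (R : realType) (m n : nat)
    (A : 'M[R]_(m, n)) (X : 'M[R]_(n, m)) (w : 'cV[R]_n) : Prop :=
  unit_vector (A *m w) /\ orthogonal_to_columns (A *m w) (A *m X).

(* Since the vectors A w_k are orthonormal, the iteration can only be continued
   finitely often.  It must be continued as long as an admissible vector exists;
   once there is none it has stopped, and X is extended by its last value (the
   remaining w_k are then irrelevant).  Asking for an admissible w_k for every k
   would be contradictory. *)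
Definition weak_pinv_iteration (R : realType) (m n : nat) (A : 'M[R]_(m, n))
    (w : nat -> 'cV[R]_n) (X : nat -> 'M[R]_(n, m)) : Prop :=
  [/\ unit_vector (A *m w 0%N),
      X 0%N = w 0%N *m (A *m w 0%N)^T,
      forall k : nat, (exists v : 'cV[R]_n, admissible A (X k) v) ->
        admissible A (X k) (w k.+1) /\
        X k.+1 = X k + w k.+1 *m (A *m w k.+1)^T
    & forall k : nat, ~ (exists v : 'cV[R]_n, admissible A (X k) v) ->
        X k.+1 = X k].

(* Main.v *)
Require Import Defs.
From HB Require Import structures.
From mathcomp Require Import all_boot all_order all_algebra.
From mathcomp Require Import all_classical all_reals all_analysis.

Set Implicit Arguments.
Unset Strict Implicit.
Unset Printing Implicit Defensive.

Import Order.TTheory GRing.Theory Num.Theory.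
Import numFieldNormedType.Exports.
Local Open Scope classical_set_scope.
Local Open Scope ring_scope.

(* The matrices A X_k are orthogonal projections, because each step adds the
   projection u u^T onto a unit vector u orthogonal to the range.  Every genuine
   step raises the trace by 1, while the trace of an m x m orthogonal projection
   is at most m, so the iteration stops.  Once it has stopped, A X A = A: a
   nonzero column of A - A X A is orthogonal to the range of A X, and normalizing
   it would give a further admissible vector. *)

Lemma dotcE (R : realType) (m : nat) (u v : 'cV[R]_m) :
  dotc u v = (u^T *m v) 0 0.
Proof. by rewrite /dotc mxE; apply: eq_bigr => i _; rewrite mxE. Qed.

Lemma dotc_ge0 (R : realType) (m : nat) (u : 'cV[R]_m) : 0 <= dotc u u.
Proof. by apply: sumr_ge0 => i _; rewrite -expr2 sqr_ge0. Qed.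

Lemma dotc_eq0 (R : realType) (m : nat) (u : 'cV[R]_m) :
  (dotc u u == 0) = (u == 0).
Proof.
apply/eqP/eqP => [/psumr_eq0P u0 | ->]; last first.
  by rewrite /dotc big1 // => i _; rewrite mxE mulr0.
apply/colP => i; rewrite mxE; apply/eqP; rewrite -sqrf_eq0 expr2.
by apply/eqP/u0 => // j _; rewrite -expr2 sqr_ge0.
Qed.

Lemma unit_vectorP (R : realType) (m : nat) (u : 'cV[R]_m) :
  unit_vector u <-> u^T *m u = 1%:M.
Proof.
rewrite /unit_vector /enorm (mx11_scalar (u^T *m u)) -dotcE.
split=> [u1 | /matrixP/(_ 0 0)]; last first.
  by rewrite !mxE eqxx !mulr1n => ->; rewrite sqrtr1.
by rewrite -(sqr_sqrtr (dotc_ge0 u)) u1 expr1n.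
Qed.

Lemma orthogonal_to_columnsP (R : realType) (m p : nat) (u : 'cV[R]_m)
    (B : 'M[R]_(m, p)) :
  orthogonal_to_columns u B <-> u^T *m B = 0.
Proof.
have dotcol j : dotc u (col j B) = (u^T *m B) 0 j.
  by rewrite dotcE !mxE; apply: eq_bigr => i _; rewrite !mxE.
split=> [uB | uB j]; last by rewrite dotcol uB mxE.
by apply/rowP => j; rewrite -dotcol uB mxE.
Qed.

Lemma mxtrace_projection_le (R : realType) (m : nat) (P : 'M[R]_m) :
  P^T = P -> P *m P = P -> \tr P <= m%:R.
Proof.
move=> symP idemP; rewrite -subr_ge0 -mxtrace1 -raddfB /=.
(* tr (1 - P) is the sum of the squared entries of 1 - P *)
have -> : 1%:M - P = (1%:M - P)^T *m (1%:M - P).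
  rewrite [_^T]raddfB /= trmx1 symP mulmxBr mulmx1 mulmxBl mul1mx idemP.
  by rewrite subrr subr0.
apply: sumr_ge0 => i _; rewrite mxE; apply: sumr_ge0 => j _.
by rewrite [_^T _ _]mxE -expr2 sqr_ge0.
Qed.

Section Iteration.
Variables (R : realType) (m n : nat) (A : 'M[R]_(m, n)).
Implicit Types (X : 'M[R]_(n, m)) (w : 'cV[R]_n).

(** Since [u^T *m u = 1] for [u = A *m w], the product [A *m X = u *m u^T] is the projection onto
    the line of [u]. This serves both as the base case of the iteration and for the increment in
    [admissible_step]. *)
Lemma rank1_outer_inverse w :
  unit_vector (A *m w) ->
  let X := w *m (A *m w)^T in
  [/\ X *m A *m X = X, self_adjoint (A *m X) & \tr (A *m X) = 1].
Proof.
move=> /unit_vectorP u1 X; rewrite /self_adjoint -mulmxA /X !(mulmxA A).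
split; last by rewrite mxtrace_mulC u1 mxtrace1.
  by rewrite -!mulmxA (mulmxA A) (mulmxA _^T) u1 mul1mx.
by rewrite trmx_mul trmxK.
Qed.

(** With [Y] the added rank-one term, both cross terms of [X' *m A *m X'] vanish, so what is known
    of [X] and [Y] separately adds up. *)
Lemma admissible_step X w :
  X *m A *m X = X -> self_adjoint (A *m X) -> admissible A X w ->
  let X' := X + w *m (A *m w)^T in
  [/\ X' *m A *m X' = X', self_adjoint (A *m X')
    & \tr (A *m X') = \tr (A *m X) + 1].
Proof.
move=> XAX symAX [uw /orthogonal_to_columnsP uAX] X'.
have [YAY symAY trAY] := rank1_outer_inverse uw.
rewrite {}/X'; set Y := w *m _ in YAY symAY trAY *.
have YAX : Y *m (A *m X) = 0 by rewrite -mulmxA uAX mulmx0.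
(* Here orthogonality does not apply directly. With [u = A *m w], transposing and the symmetry of
   [A *m X] give [A X u = 0]; then [X = X A X] gives [X u = 0]. *)
have XAY : X *m (A *m Y) = 0.
  have AXu : A *m X *m (A *m w) = 0.
    by rewrite -symAX -[A *m w]trmxK -trmx_mul uAX trmx0.
  have Xu : X *m (A *m w) = 0.
    by rewrite -XAX -2!mulmxA (mulmxA A X) AXu mulmx0.
  by rewrite /Y !mulmxA -(mulmxA X) Xu mul0mx.
clearbody Y; split; last by rewrite mulmxDr raddfD /= trAY.
  rewrite -mulmxA mulmxDr mulmxDl !mulmxDr YAX XAY addr0 add0r.
  by rewrite !mulmxA XAX YAY.
by rewrite /self_adjoint mulmxDr linearD /= symAX symAY.
Qed.

Lemma admissible_exists X :
  X *m A *m X = X -> self_adjoint (A *m X) -> A *m X *m A != A ->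
  exists w, admissible A X w.
Proof.
move=> XAX symAX; rewrite eq_sym -subr_eq0 => D0.
have [j Dj0] : exists j, col j (A - A *m X *m A) != 0.
  apply/existsP; apply: contraR D0; rewrite negb_exists => /forallP D0.
  apply/eqP/matrixP => i j; have /negPn/eqP/colP/(_ i) := D0 j.
  by rewrite [LHS]mxE [RHS]mxE => ->; rewrite mxE.
rewrite colE in Dj0; set e := delta_mx j 0 in Dj0; set u := _ *m e in Dj0.
(* The column [u] must lie in the range of [A]: as [A - A X A = A (1 - X A)], this [v] is a preimage
   of it. *)
pose v := (1%:M - X *m A) *m e.
have Av : A *m v = u by rewrite /v mulmxA mulmxBr mulmx1 mulmxA.
have d0 : 0 < dotc u u by rewrite lt_neqAle dotc_ge0 eq_sym dotc_eq0 Dj0.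
(* [u = (1 - A X) A e], and the symmetric idempotent [A X] annihilates [1 - A X]. *)
have uAX : u^T *m (A *m X) = 0.
  have AXAX : A *m X *m (A *m X) = A *m X by rewrite -mulmxA (mulmxA X) XAX.
  rewrite -symAX -trmx_mul /u mulmxA mulmxBr (mulmxA (A *m X)) AXAX.
  by rewrite subrr mul0mx trmx0.
exists ((enorm u)^-1 *: v); rewrite /admissible -scalemxAr Av; split.
  apply/unit_vectorP; rewrite -scalemxAr [_^T]linearZ /= -scalemxAl scalerA.
  rewrite (mx11_scalar (u^T *m u)) -dotcE -(sqr_sqrtr (dotc_ge0 u)).
  rewrite -scalemx1 scalerA -invfM -expr2 mulVf ?scale1r //.
  by rewrite sqrf_eq0 sqrtr_eq0 -ltNge.
by apply/orthogonal_to_columnsP; rewrite [_^T]linearZ /= -scalemxAl uAX scaler0.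
Qed.

End Iteration.

Theorem theorem3 (R : realType) (m n : nat) (A : 'M[R]_(m, n))
    (w : nat -> 'cV[R]_n) (X : nat -> 'M[R]_(n, m)) :
  weak_pinv_iteration A w X ->
  exists Xlim : 'M[R]_(n, m),
    (X k @[k --> \oo] --> Xlim) /\ weak_pseudoinverse A Xlim.
Proof.
move=> [w0 X0 step stop].
pose can_step k := exists v, admissible A (X k) v.
(* Conditions (2) and (3) hold at every index; (1) holds only once the iteration has stopped. *)
have inv k : X k *m A *m X k = X k /\ self_adjoint (A *m X k).
  elim: k => [|k [XAX symAX]].
    by rewrite X0; have [] := rank1_outer_inverse w0.
  have [/step[adm ->] | /stop -> //] := pselect (can_step k).
  by have [] := admissible_step XAX symAX adm.
have [K stopK] : exists K, ~ can_step K.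
  apply/existsNP => steps.
  (* The start already has trace 1, so at index [m] the trace would be [m + 1], above the bound
     [m]. *)
  have trE k : \tr (A *m X k) = k.+1%:R.
    elim: k => [|k IHk].
      by rewrite X0; have [] := rank1_outer_inverse w0.
    have [[XAX symAX] [adm ->]] := (inv k, step k (steps k)).
    by have [_ _ ->] := admissible_step XAX symAX adm; rewrite IHk [RHS]mulrSr.
  have [XAX symAX] := inv m.
  have := mxtrace_projection_le symAX _.
  by rewrite trE ler_nat ltnn -mulmxA (mulmxA (X m)) XAX => /(_ erefl).
(* Admissibility depends only on the current matrix, so a stopped iteration stays stopped. *)
have Xconst k : X (k + K)%N = X K.
  elim: k => [//|k IHk]; rewrite addSn stop IHk //.
exists (X K); split.
  by rewrite -(cvg_shiftn K); under eq_fun do rewrite Xconst; exact: cvg_cst.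
have [XAX symAX] := inv K; split=> //.
by apply/eqP; apply: contra_notT stopK; exact: admissible_exists.
Qed.
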